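(* Let $(A,P)$ be a Rota-Baxter (associative) algebra of weight $\lambda\in\mathbf k$ in characteristic $p>0$. Let $[-,-]$ be the commutator of $A$, $(-)^p$ the $p$-th power map of $A$, and $x\rhd_Py:=[P(x),y]=P(x)y-yP(x)$. Then $(A,\lambda[-,-],\lambda^{p-1}(-)^p,\rhd_P)$ is a restricted post-Lie algebra.
   Context: Convention: $\mathbf k$ is an algebraically closed field of prime characteristic $p$; everything is over $\mathbf k$. A Rota-Baxter algebra of weight $\lambda$ is an associative algebra $A$ with a linear map $P:A\to A$ such that $P(x)P(y)=P(P(x)y)+P(xP(y))+\lambda P(xy)$ for all $x,y\in A$. Restricted Lie algebra: a Lie algebra $(\mathfrak g,[-,-])$ with a $p$-map $(-)^{[p]}:\mathfrak g\to\mathfrak g$ satisfying $(ax)^{[p]}=a^px^{[p]}$ for $a\in\mathbf k$, $[x^{[p]},y]=(\mathrm{ad}_x)^p(y)$, and $(x+y)^{[p]}=x^{[p]}+y^{[p]}+\sum_{i=1}^{p-1}s_i(x,y)$, where $i\,s_i(x,y)$ is the coefficient of $t^{i-1}$ in $(\mathrm{ad}_{tx+y})^{p-1}(x)\in\mathbf k[t]\otimes\mathfrak g$. Post-Lie algebra: a Lie algebra $(\mathfrak g,[-,-])$ with a bilinear product $\rhd$ such that $x\rhd[y,z]=[x\rhd y,z]+[y,x\rhd z]$ and $([x,y]+x\rhd y-y\rhd x)\rhd z=x\rhd(y\rhd z)-y\rhd(x\rhd z)$. For a composition $\alpha=(\alpha_1,\dots,\alpha_r)\vDash n$ (a tuple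 of positive integers with sum $n$, of length $\ell(\alpha)=r$), $C_\alpha=\prod_{k=1}^r\binom{\alpha_1+\cdots+\alpha_k-1}{\alpha_k-1}$. Restricted post-Lie algebra $(\mathfrak g,[-,-],(-)^{[p]},\rhd)$: a post-Lie algebra such that $(\mathfrak g,[-,-],(-)^{[p]})$ is a restricted Lie algebra and, for all $x,y$, $y\rhd x^{[p]}=(\mathrm{ad}_x)^{p-1}(y\rhd x)$ and $x^{\llbracket p\rrbracket}\rhd y=\underbrace{x\rhd(x\rhd\cdots(x}_{p}\rhd y)\cdots)$, where $$x^{\llbracket p\rrbracket}=x^{[p]}+\sum_{r=1}^{p-1}\frac1r\sum_{\alpha\vDash p,\ \ell(\alpha)=r}C_\alpha\,[x^{\rhd\alpha_1},[x^{\rhd\alpha_2},[\cdots[x^{\rhd\alpha_{r-1}},x^{\rhd\alpha_r}]\cdots]]],$$ with $x^{\rhd k}=x\rhd(x\rhd\cdots(x\rhd x)\cdots)$ ($k$ copies of $x$, $x^{\rhd 1}=x$), and $\frac1r$ the inverse of $r$ modulo $p$. *)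

(* Defs.v *)
From HB Require Import structures.
From mathcomp Require Import all_boot all_order all_algebra.

Set Implicit Arguments.
Unset Strict Implicit.
Unset Printing Implicit Defensive.

Import GRing.Theory.
Local Open Scope ring_scope.

Section Algebras.
Variables (k : fieldType) (A : lmodType k).
Implicit Types (mul : A -> A -> A) (P : A -> A) (lambda : k) (x y : A).

(* Algebras need not be unital (nor nonzero), so the product is not taken from
   an [algType] structure; for an [algType] take [mul := *%R]. *)
Record assoc_algebra mul : Prop := AssocAlgebra {
  assoc_algebra_bilinear : bilinear_for *:%R *:%R mul;
  assoc_algebra_assoc : associative mul
}.

Record rota_baxter_algebra lambda mul P : Prop := RotaBaxterAlgebra {
  rota_baxter_assoc_algebra : assoc_algebra mul;
  rota_baxter_linear : linear P;
  rota_baxter_identity : forall x y,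
    mul (P x) (P y) =
    P (mul (P x) y) + P (mul x (P y)) + lambda *: P (mul x y)
}.

Definition commutator mul x y : A := mul x y - mul y x.

(* The [n]-fold right-nested product x (x (... (x x))) with [n] copies of [x],
   meaningful for [n >= 1]. It is the [n]-th power when [mul] is associative. *)
Definition nested_pow mul (n : nat) x : A := iter n.-1 (mul x) x.

End Algebras.

Section LieAlgebras.
Variables (k : fieldType) (g : lmodType k).
Implicit Types (br rhd : g -> g -> g) (pmap : g -> g) (x y z : g) (p : nat).

(* Alternating rather than antisymmetric, because of characteristic 2. *)
Record lie_algebra br : Prop := LieAlgebra {
  lie_bilinear : bilinear_for *:%R *:%R br;
  lie_alternating : forall x, br x x = 0;
  lie_jacobi : forall x y z, br x (br y z) + br y (br z x) + br z (br x y) = 0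
}.

(* An element of k[t] (x) g is represented by its sequence of coefficients in
   the powers of t; [bracket_t] is the k[t]-bilinear extension of [br]. *)
Definition bracket_t br (u v : nat -> g) : nat -> g :=
  fun n => \sum_(i < n.+1) br (u i) (v (n - i)%N).

Definition const_t x : nat -> g := fun n => if n is 0 then x else 0.

(* t x + y *)
Definition line_t x y : nat -> g :=
  fun n => match n with 0 => y | 1 => x | _ => 0 end.

(* s_i(x, y), where i s_i(x, y) is the coefficient of t^(i-1) in
   (ad_(t x + y))^(p-1) (x); used for 1 <= i < p only, where i is invertible. *)
Definition jacobson_s p br (i : nat) x y : g :=
  (i%:R : k)^-1 *: iter p.-1 (bracket_t br (line_t x y)) (const_t x) i.-1.

Record restricted_lie_algebra p br pmap : Prop := RestrictedLieAlgebra {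
  restricted_lie : lie_algebra br;
  pmap_scale : forall (a : k) x, pmap (a *: x) = a ^+ p *: pmap x;
  pmap_ad : forall x y, br (pmap x) y = iter p (br x) y;
  pmap_add : forall x y,
    pmap (x + y) = pmap x + pmap y + \sum_(1 <= i < p) jacobson_s p br i x y
}.

Record post_lie_algebra br rhd : Prop := PostLieAlgebra {
  post_lie : lie_algebra br;
  post_lie_bilinear : bilinear_for *:%R *:%R rhd;
  post_lie_derivation : forall x y z,
    rhd x (br y z) = br (rhd x y) z + br y (rhd x z);
  post_lie_action : forall x y z,
    rhd (br x y + rhd x y - rhd y x) z = rhd x (rhd y z) - rhd y (rhd x z)
}.

Definition is_composition (n : nat) (alpha : seq nat) : bool :=
  all (leq 1) alpha && (sumn alpha == n).

Definition comp_coef (alpha : seq nat) : nat :=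
  (\prod_(j < size alpha)
     'C((sumn (take j.+1 alpha)).-1, (nth 0 alpha j).-1))%N.

(* [u1, [u2, [... [u_(r-1), u_r] ...]]], equal to u1 when r = 1; the value on
   the empty sequence is irrelevant. *)
Fixpoint nested_bracket br (s : seq g) : g :=
  match s with
  | [::] => 0
  | [:: u] => u
  | u :: s' => br u (nested_bracket br s')
  end.

(* The parts of a composition of p are at most p, so the compositions of p of
   length r are among the r-tuples over 'I_p.+1. *)
Definition sub_pmap p br pmap rhd x : g :=
  pmap x +
  \sum_(1 <= r < p) (r%:R : k)^-1 *:
    \sum_(alpha : r.-tuple 'I_p.+1 | is_composition p (map val alpha))
      nested_bracket br [seq nested_pow rhd (val a) x | a <- alpha]
        *+ comp_coef (map val alpha).

Record restricted_post_lie_algebra p br pmap rhd : Prop :=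
  RestrictedPostLieAlgebra {
  restricted_post_lie : post_lie_algebra br rhd;
  restricted_post_lie_restricted : restricted_lie_algebra p br pmap;
  restricted_post_lie_rhd_pmap : forall x y,
    rhd y (pmap x) = iter p.-1 (br x) (rhd y x);
  restricted_post_lie_sub_pmap_rhd : forall x y,
    rhd (sub_pmap p br pmap rhd x) y = iter p (rhd x) y
}.

End LieAlgebras.

(* Main.v *)
Require Import Defs.
From HB Require Import structures.
From mathcomp Require Import all_boot all_order all_algebra.

(**
  Embed A in its unitization U. For x in A put a := P x and, over U[t],
  L := t x + a. In characteristic p, L^p has derivative (ad L)^(p-1) (x), which
  determines its coefficients of degree 1, ..., p-1 and gives Jacobson's formula
  for (x + y)^p. Expanding (t ad_x + ad_a)^(p-1) (x) over the nested brackets of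
  the elements (ad_a)^(i-1) (x) produces the coefficients C_alpha, so that the
  element x^[[p]] equals ((a + lambda x)^p - a^p) / lambda, read as a polynomial
  in lambda. That polynomial is also the p-th power of x for the associative
  product x * y := P(x) y + x P(y) + lambda x y, and P maps * to the product of
  A. Hence P(x^[[p]]) = P(x)^p, and (ad u)^p = ad (u^p) concludes.
*)

Set Implicit Arguments.
Unset Strict Implicit.
Unset Printing Implicit Defensive.

Import GRing.Theory.
Local Open Scope ring_scope.

(** * Powers of [ad u] in characteristic p *)

Section AdjointPowers.
Variable R : nzRingType.
Implicit Types (u v x y : R).

Definition ad u v : R := u * v - v * u.

(** Left and right multiplication by [u] commute, so the n-th power of their difference expands by
    the binomial theorem. *)
Lemma iter_adE n u v :
  iter n (ad u) v =
  \sum_(i < n.+1) ((-1) ^+ i * (u ^+ (n - i) * v * u ^+ i)) *+ 'C(n, i).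
Proof.
elim: n => [|n IHn]; first by rewrite big_ord1 /= !expr0 !mul1r mulr1.
rewrite iterS IHn /ad mulr_sumr mulr_suml big_ord_recl [in RHS]big_ord_recl /=.
rewrite -addrA subn0 !bin0 !expr0 !mul1r !mulr1 mulrA -exprS; congr (_ + _).
under [RHS]eq_bigr => i _ do rewrite binS mulrnDr.
rewrite big_split /=; congr (_ + _).
  rewrite [RHS]big_ord_recr /= bin_small // mulr0n addr0; apply: eq_bigr => i _.
  rewrite mulrnAr; congr (_ *+ _).
  rewrite !mulrA (commrX _ (commrN1 u)) -!mulrA (mulrA u (u ^+ _)) -exprS subSS.
  by rewrite -subSn.
rewrite -sumrN; apply: eq_bigr => i _.
rewrite mulrnAl -mulNrn subSS; congr (_ *+ _).
by rewrite /bump /= add1n exprS mulN1r mulNr !mulrA exprSr mulrA.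
Qed.

Variables (p : nat) (pcharRp : p \in [pchar R]).

(** Since p divides 'C(p, i+1) for 0 < i+1 < p, Pascal's rule makes consecutive 'C(p-1, i) opposite
    modulo p. *)
Lemma signed_bin_pred_pchar i :
  (i < p)%N -> (-1) ^+ i *+ 'C(p.-1, i) = 1 :> R.
Proof.
have p_pr := pcharf_prime pcharRp.
elim: i => [|i IHi] lt_ip; first by rewrite bin0.
have /(prime_dvd_bin p_pr) : (0 < i.+1 < p)%N by [].
rewrite -{2}(prednK (prime_gt0 p_pr)) binS /=.
rewrite (dvdn_pcharf pcharRp) natrD addr_eq0 => /eqP binE.
by rewrite -mulr_natr binE exprS mulN1r mulrNN mulr_natr IHi // ltnW.
Qed.

Lemma iter_ad_pred_pchar u v :
  iter p.-1 (ad u) v = \sum_(i < p) u ^+ (p.-1 - i) * v * u ^+ i.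
Proof.
rewrite iter_adE; have p_pr := pcharf_prime pcharRp.
rewrite prednK ?prime_gt0 //; apply: eq_bigr => i _.
by rewrite -mulrnAl signed_bin_pred_pchar // mul1r.
Qed.

(** One more [ad u] makes the sum of [iter_ad_pred_pchar] telescope to its two extreme terms. *)
Lemma iter_ad_pchar u v : iter p (ad u) v = ad (u ^+ p) v.
Proof.
have := pcharf_prime pcharRp; case: p iter_ad_pred_pchar => // q iter_adq _.
rewrite iterS iter_adq /ad mulr_sumr mulr_suml.
rewrite big_ord_recl [X in _ - X]big_ord_recr /= subn0 subnn.
rewrite !expr0 !mulr1 !mul1r -!mulrA -exprSr mulrA -exprS.
rewrite opprD addrA -[X in X - _]addrA -sumrB big1 ?addr0 // => i _.
rewrite !mulrA -exprS -!mulrA -exprSr /bump /= add1n.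
by rewrite -subSn // subSS subrr.
Qed.

End AdjointPowers.

(** * Powers of t x + y over a noncommutative ring *)

Section LinePowers.
Variable R : nzRingType.
Implicit Types (x y : R) (q : {poly R}).

Definition line_poly x y : {poly R} := x%:P * 'X + y%:P.

Lemma coef_line_polyM x y q i :
  (line_poly x y * q)`_i = (if i is j.+1 then x * q`_j else 0) + y * q`_i.
Proof.
by rewrite mulrDl -mulrA coefD !coefCM coefXM; case: i => //=; rewrite mulr0.
Qed.

Lemma coef_mul_line_poly x y q i :
  (q * line_poly x y)`_i = (if i is j.+1 then q`_j * x else 0) + q`_i * y.
Proof. by rewrite mulrDr mulrA coefD coefMX !coefMC; case: i. Qed.

Lemma coef0_line_exp x y n : (line_poly x y ^+ n)`_0 = y ^+ n.
Proof.
elim: n => [|n IHn]; first by rewrite !expr0 coefC.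
by rewrite !exprS coef_line_polyM IHn add0r.
Qed.

Lemma coef_line_exp_gt x y n i : (n < i)%N -> (line_poly x y ^+ n)`_i = 0.
Proof.
elim: n i => [|n IHn] [|i] //=; first by rewrite expr0 coefC.
by move=> lt_ni; rewrite exprS coef_line_polyM !IHn ?mulr0 ?addr0 // ltnW.
Qed.

Lemma coefn_line_exp x y n : (line_poly x y ^+ n)`_n = x ^+ n.
Proof.
elim: n => [|n IHn]; first by rewrite !expr0 coefC.
by rewrite !exprS coef_line_polyM IHn coef_line_exp_gt // mulr0 addr0.
Qed.

(** Leibniz rule; [q] need not commute with its derivative, so the n terms stay separate. *)
Lemma deriv_exp q n :
  (q ^+ n)^`() = \sum_(i < n) q ^+ (n.-1 - i) * q^`() * q ^+ i.
Proof.
elim: n => [|n IHn]; first by rewrite expr0 derivC big_ord0.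
rewrite exprSr derivM IHn mulr_suml [RHS]big_ord_recl /= subn0 expr0 mulr1.
rewrite addrC; congr (_ + _); apply: eq_bigr => i _.
by rewrite /bump /= add1n -mulrA -exprSr subnS -subn1 subnAC subn1.
Qed.

Lemma deriv_line_poly x y : (line_poly x y)^`() = x%:P.
Proof. by rewrite derivMXaddC derivC mul0r addr0. Qed.

(** For L = t x + y, the Leibniz sum for the derivative of L^p is the sum of [iter_ad_pred_pchar],
    as L has derivative x. *)
Lemma coef_line_exp_pchar p x y i : p \in [pchar R] ->
  (line_poly x y ^+ p)`_i.+1 *+ i.+1 =
  (iter p.-1 (ad (line_poly x y)) x%:P)`_i.
Proof.
move=> pcharRp; have pcharRXp : p \in [pchar {poly R}] by rewrite pchar_poly.
by rewrite iter_ad_pred_pchar // -coef_deriv deriv_exp deriv_line_poly.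
Qed.

End LinePowers.

(** * Peeling off the first part of a composition *)

Lemma big_tuple_cons (V : nmodType) (T : finType) r (Q : pred (seq T))
    (G : seq T -> V) :
  \sum_(a : r.+1.-tuple T | Q a) G a =
  \sum_(b : T) \sum_(a : r.-tuple T | Q (b :: a)) G (b :: a).
Proof.
rewrite pair_big_dep /=.
rewrite (reindex (fun z : T * r.-tuple T => [tuple of z.1 :: z.2])) //=.
exists (fun a : r.+1.-tuple T => (thead a, [tuple of behead a])) => [[b a]|a] _.
  by congr (_, _); apply: val_inj.
by rewrite /= -tuple_eta.
Qed.

Lemma is_composition_cons n b s :
  is_composition n (b :: s) = (0 < b <= n)%N && is_composition (n - b) s.
Proof.
rewrite /is_composition /=; case: (leqP b n) => [le_bn|lt_nb].
  by rewrite -{1}(subnKC le_bn) eqn_add2l andbT andbA.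
rewrite andbF /=; apply/negbTE/nandP; right; rewrite neq_ltn.
by rewrite (leq_trans lt_nb) ?leq_addr ?orbT.
Qed.

(* C_(m, s) for m > 0, and C_s for m = 0. *)
Fixpoint comp_coef_from (m : nat) (s : seq nat) : nat :=
  if s is b :: s' then ('C((m + b).-1, b.-1) * comp_coef_from (m + b) s')%N
  else 1.

(** A factor of C_alpha sees the earlier parts only through their sum, which the recursion carries
    as [m]. *)
Lemma comp_coef_fromE s : comp_coef s = comp_coef_from 0 s.
Proof.
suff coefE m : comp_coef_from m s = (\prod_(j < size s)
  'C((m + sumn (take j.+1 s)).-1, (nth 0 s j).-1))%N by rewrite coefE.
elim: s m => [|b s IHs] m /=; first by rewrite big_ord0.
rewrite big_ord_recl /= take0 /= addn0; rewrite IHs; congr (_ * _)%N.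
by apply: eq_bigr => j _; rewrite addnA.
Qed.

(** * Expansion of (t ad_x + D)^n (x) for a derivation D *)

Section CompositionSums.
Variables (k : fieldType) (g : lmodType k).
Variables (br : {bilinear g -> g -> g}) (D : {additive g -> g}).
Hypothesis D_br : forall u v, D (br u v) = br (D u) v + br u (D v).
Variable x : g.

(* The compositions of n here have r.+1 parts; see [comp_sumE]. *)
Fixpoint comp_sum (r m n : nat) : g :=
  match r with
  | 0 => if n is n'.+1 then iter n' D x *+ 'C(m + n', n') else 0
  | r'.+1 => \sum_(c < n)
      br (iter c D x) (comp_sum r' (m + c.+1) (n - c.+1)) *+ 'C(m + c, c)
  end.

Lemma comp_sum0 r m : comp_sum r m 0 = 0.
Proof. by case: r => //= r; rewrite big_ord0. Qed.

(** The bound [N] on the parts is separate from [n], so that the type of the tuples stays fixed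
    while [n] decreases. *)
Lemma comp_sumE N r m n : (n <= N)%N ->
  \sum_(a : r.+1.-tuple 'I_N.+1 | is_composition n (map val a))
    nested_bracket br [seq iter (val i).-1 D x | i <- a]
      *+ comp_coef_from m (map val a) = comp_sum r m n.
Proof.
elim: r m n => [|r IHr] m n le_nN.
  rewrite (big_tuple_cons _
    (fun a : seq 'I_N.+1 => is_composition n (map val a))
    (fun a : seq 'I_N.+1 => nested_bracket br [seq iter (val i).-1 D x | i <- a]
      *+ comp_coef_from m (map val a))) /=.
  (* The only candidate with one part is (n), itself excluded when n = 0. *)
  rewrite (bigD1 (Ordinal (le_nN : (n < N.+1)%N))) //=.
  rewrite [X in _ + X]big1 => [|b ne_bn]; last first.
    rewrite big1 // => a; rewrite tuple0 /= is_composition_cons.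
    rewrite /is_composition /= => /andP[/andP[_ le_bn]].
    rewrite eq_sym subn_eq0 => le_nb.
    by case/eqP: ne_bn; apply: val_inj; apply/eqP; rewrite eqn_leq le_bn.
  rewrite addr0; case: n le_nN => [|n] le_nN.
    by rewrite big1 // => a; rewrite is_composition_cons.
  rewrite (big_pred1 [tuple]) /= => [|a]; last first.
    by rewrite [a]tuple0 is_composition_cons leqnn subnn /= (eqxx [tuple]).
  by rewrite muln1 addnS.
rewrite (big_tuple_cons _ (fun a : seq 'I_N.+1 => is_composition n (map val a))
    (fun a : seq 'I_N.+1 => nested_bracket br [seq iter (val i).-1 D x | i <- a]
      *+ comp_coef_from m (map val a))) /=.
(* A first part 0 is excluded; the others are c + 1, with c the index in [comp_sum]. *)
rewrite big_ord_recl /= big1 ?add0r => [|a]; last first.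
  by rewrite is_composition_cons.
rewrite (big_ord_widen N
  (fun c => br (iter c D x) (comp_sum r (m + c.+1) (n - c.+1)) *+ 'C(m + c, c)))
  // [RHS]big_mkcond /=.
apply: eq_bigr => c _; rewrite /bump /= add1n.
under eq_bigl => a do rewrite is_composition_cons.
case: (ltnP c n) => lt_cn; last by rewrite big_pred0.
rewrite -IHr; last exact: leq_trans (leq_subr _ _) le_nN.
rewrite linear_sumr -sumrMnl; apply: eq_bigr => a _.
rewrite linearMnr -mulrnA mulnC addnS /=; congr (_ *+ _).
by case/tupleP: a.
Qed.

(* [comp_sum_step] and [comp_sum_step0] sort set partitions by the block of their
   least element. *)
Lemma comp_sum_step r m n :
  D (comp_sum r m.+1 n) + comp_sum r m n.+1 = comp_sum r m.+1 n.+1.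
Proof.
elim: r m n => [|r IHr] m n /=.
  case: n => [|n]; first by rewrite raddf0 add0r !bin0.
  by rewrite raddfMn /= -mulrnDr addSn [in RHS]addnS binS addnC addnS.
pose T c := br (iter c D x) (comp_sum r (m + c.+1) (n.+1 - c.+1)).
have T_n : T n = 0 by rewrite /T subnn comp_sum0 linear0r.
rewrite [RHS]big_ord_recr /= subnn comp_sum0 linear0r mul0rn addr0.
(* The induction hypothesis produces [T c]; differentiating the first entry of the bracket produces
   [T c.+1], which must be subtracted. *)
have -> : \sum_(c < n) br (iter c D x) (comp_sum r (m.+1 + c.+1) (n.+1 - c.+1))
           *+ 'C(m.+1 + c, c) =
    D (\sum_(c < n) br (iter c D x) (comp_sum r (m.+1 + c.+1) (n - c.+1))
           *+ 'C(m.+1 + c, c)) +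
    \sum_(c < n) (T c - T c.+1) *+ 'C(m.+1 + c, c).
  rewrite raddf_sum -big_split /=; apply: eq_bigr => c _.
  rewrite raddfMn -mulrnDl D_br /T -iterS; congr (_ *+ _).
  rewrite !addSn [(m + c.+2)%N]addnS !subSS -(subnSK (ltn_ord c)) -IHr linearDr.
  by rewrite [X in _ = X + _]addrC addrACA subrr addr0.
congr (_ + _).
(* Summation by parts: [T n = 0] closes the range, and Pascal's rule combines the binomials. *)
under [RHS]eq_bigr => c _ do rewrite mulrnBl.
rewrite sumrB; apply/eqP; rewrite eq_sym subr_eq; apply/eqP.
transitivity (\sum_(c < n.+1) T c *+ 'C(m.+1 + c, c)).
  by rewrite [RHS]big_ord_recr /= T_n mul0rn addr0.
rewrite !big_ord_recl /= !bin0 -addrA; congr (_ + _).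
rewrite -big_split /=; apply: eq_bigr => c _.
by rewrite /bump /= add1n -mulrnDr addnS binS addSnnS addnS.
Qed.

Lemma comp_sum_step0 r n :
  D (comp_sum r.+1 0 n) + br x (comp_sum r 0 n) = comp_sum r.+1 0 n.+1.
Proof.
pose S c := br (iter c D x) (comp_sum r c (n - c)).
have S_n : S n = 0 by rewrite /S subnn comp_sum0 linear0r.
rewrite /= [RHS]big_ord_recr /= subnn comp_sum0 linear0r mul0rn addr0.
(* The bracket is [S 0], spread over a telescoping sum so that each difference corrects one term of
   the derivation. *)
have -> : br x (comp_sum r 0 n) = \sum_(c < n) (S c - S c.+1).
  rewrite -(big_mkord xpredT (fun c => S c - S c.+1)).
  under eq_bigr => c _ do rewrite -opprB.
  by rewrite sumrN telescope_sumr // S_n sub0r opprK /S subn0.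
rewrite raddf_sum -big_split /=; apply: eq_bigr => c _.
rewrite !add0n binn !mulr1n D_br /S iterS subSS -[in RHS](subnSK (ltn_ord c)).
rewrite -comp_sum_step linearDr /= subnSK //.
by rewrite [X in X + _ = _]addrC addrACA subrr addr0.
Qed.

(* [twisted_iter n r] is the coefficient of t^r in (t ad_x + D)^n (x). *)
Fixpoint twisted_iter (n r : nat) : g :=
  if n is n'.+1 then
    (if r is r'.+1 then br x (twisted_iter n' r') else 0)
      + D (twisted_iter n' r)
  else if r is 0 then x else 0.

Lemma twisted_iterS n r : twisted_iter n.+1 r =
  (if r is r'.+1 then br x (twisted_iter n r') else 0) + D (twisted_iter n r).
Proof. by []. Qed.

(** [comp_sum_step0] is the defining recursion of [twisted_iter]; only the boundary cases remain. *)
Lemma twisted_iterE n r : twisted_iter n r = comp_sum r 0 n.+1.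
Proof.
elim: n r => [|n IHn] [|r]; first by [].
- by rewrite /= big_ord1 comp_sum0 linear0r.
- by rewrite /= IHn /= !add0n !binn add0r.
by rewrite -[RHS]comp_sum_step0 addrC -!IHn.
Qed.

Lemma twisted_iter_comp n r :
  twisted_iter n r =
  \sum_(a : r.+1.-tuple 'I_n.+2 | is_composition n.+1 (map val a))
    nested_bracket br [seq iter (val i).-1 D x | i <- a]
      *+ comp_coef (map val a).
Proof.
rewrite twisted_iterE -(comp_sumE _ _ (leqnn n.+1)).
by apply: eq_bigr => a _; rewrite comp_coef_fromE.
Qed.

End CompositionSums.

(** * Adjoining a unit to an associative algebra *)

Section Unitization.
Variables (k : fieldType) (A : lmodType k) (mul : A -> A -> A).
Hypothesis assoc_mul : assoc_algebra mul.

(** The proof of associativity indexes the type, so that the ring instances can depend on it and on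
    [mul]. *)
Definition unitization of assoc_algebra mul : Type := (k^o * A)%type.
Local Notation U := (unitization assoc_mul).

HB.instance Definition _ := GRing.Lmodule.copy U (k^o * A)%type.

Lemma assoc_mulDl : left_distributive mul +%R.
Proof.
move=> x y z; have [/(_ z) lin _] := assoc_algebra_bilinear assoc_mul.
by have := lin 1 x y; rewrite /= !scale1r.
Qed.

Lemma assoc_mulDr : right_distributive mul +%R.
Proof.
move=> x y z; have [_ /(_ x) lin] := assoc_algebra_bilinear assoc_mul.
by have := lin 1 y z; rewrite /= !scale1r.
Qed.

Lemma assoc_mul0l x : mul 0 x = 0.
Proof. by apply: (addIr (mul 0 x)); rewrite -assoc_mulDl !add0r. Qed.

Lemma assoc_mul0r x : mul x 0 = 0.
Proof. by apply: (addIr (mul x 0)); rewrite -assoc_mulDr !add0r. Qed.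

Lemma assoc_mulZl c x y : mul (c *: x) y = c *: mul x y.
Proof.
have [/(_ y) lin _] := assoc_algebra_bilinear assoc_mul.
by have := lin c x 0; rewrite /= addr0 assoc_mul0l addr0.
Qed.

Lemma assoc_mulZr c x y : mul x (c *: y) = c *: mul x y.
Proof.
have [_ /(_ x) lin] := assoc_algebra_bilinear assoc_mul.
by have := lin c y 0; rewrite /= addr0 assoc_mul0r addr0.
Qed.

Definition unitization_one : U := (1, 0).

Definition unitization_mul (u v : U) : U :=
  (u.1 * v.1, u.1 *: v.2 + v.1 *: u.2 + mul u.2 v.2).

Let unitization_mulA : associative unitization_mul.
Proof.
move=> [a x] [b y] [c z]; congr (_, _); rewrite /= ?mulrA //.
rewrite !(assoc_mulDl, assoc_mulDr, assoc_mulZl, assoc_mulZr, scalerDr).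
rewrite (assoc_algebra_assoc assoc_mul) !scalerA -!addrA.
rewrite (mulrC c a) (mulrC c b).
congr (_ + (_ + _)); rewrite addrCA; congr (_ + _).
by rewrite [RHS]addrCA; congr (_ + _); rewrite addrCA.
Qed.

Let unitization_mul1l : left_id unitization_one unitization_mul.
Proof.
case=> a x; rewrite /unitization_mul /= mul1r scale1r scaler0.
by rewrite assoc_mul0l !addr0.
Qed.

Let unitization_mul1r : right_id unitization_one unitization_mul.
Proof.
case=> a x; rewrite /unitization_mul /= mulr1 scale1r scaler0.
by rewrite assoc_mul0r addr0 add0r.
Qed.

Let unitization_mulDl : left_distributive unitization_mul +%R.
Proof.
move=> [a x] [b y] [c z]; congr (_, _); rewrite /= ?mulrDl //.
rewrite scalerDl scalerDr assoc_mulDl [RHS]addrACA.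
by congr (_ + _); rewrite addrACA.
Qed.

Let unitization_mulDr : right_distributive unitization_mul +%R.
Proof.
move=> [a x] [b y] [c z]; congr (_, _); rewrite /= ?mulrDr //.
rewrite scalerDl scalerDr assoc_mulDr [RHS]addrACA.
by congr (_ + _); rewrite addrACA.
Qed.

Let unitization_one_neq0 : unitization_one != 0.
Proof. by apply/eqP => -[] /eqP; rewrite oner_eq0. Qed.

HB.instance Definition _ := GRing.Zmodule_isNzRing.Build U unitization_mulA
  unitization_mul1l unitization_mul1r unitization_mulDl unitization_mulDr
  unitization_one_neq0.

Let unitization_scaleAl c (u v : U) : c *: (u * v) = c *: u * v.
Proof.
case: u v => [a x] [b y]; congr (_, _) => /=; first exact: mulrA.
by rewrite assoc_mulZl !scalerDr !scalerA (mulrC b).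
Qed.

HB.instance Definition _ :=
  GRing.Lmodule_isLalgebra.Build k U unitization_scaleAl.

Let unitization_scaleAr c (u v : U) : c *: (u * v) = u * (c *: v).
Proof.
case: u v => [a x] [b y]; congr (_, _) => /=; first exact: mulrCA.
by rewrite assoc_mulZr !scalerDr !scalerA (mulrC c a).
Qed.

HB.instance Definition _ :=
  GRing.Lalgebra_isAlgebra.Build k U unitization_scaleAr.

Definition unitize (x : A) : U := (0, x).

Let unitize_linear : linear unitize.
Proof. by move=> c x y; congr (_, _); rewrite /= [_ *: _]mulr0 addr0. Qed.

HB.instance Definition _ :=
  GRing.isLinear.Build k A U *:%R unitize unitize_linear.

Lemma unitize_inj : injective unitize.
Proof. by move=> x y []. Qed.

Lemma unitizeM : {morph unitize : x y / mul x y >-> x * y}.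
Proof.
by move=> x y; congr (_, _); rewrite /= ?mulr0 // !scale0r !add0r.
Qed.

End Unitization.

(** * Commutators and powers of c x + y in a unital algebra *)

Section AdjointAlgebra.
Variables (k : fieldType) (R : algType k).
Implicit Types (c : k) (u v w x y : R) (q : {poly R}).

Lemma adN u v : ad u v = - ad v u.
Proof. by rewrite /ad opprB. Qed.

Lemma adZr c u v : ad u (c *: v) = c *: ad u v.
Proof. by rewrite /ad scalerBr -scalerAl -scalerAr. Qed.

Lemma adZl c u v : ad (c *: u) v = c *: ad u v.
Proof. by rewrite /ad scalerBr -scalerAl -scalerAr. Qed.

Lemma adDr u v w : ad u (v + w) = ad u v + ad u w.
Proof. by rewrite /ad mulrDr mulrDl opprD addrACA. Qed.

Lemma adDl u v w : ad (u + v) w = ad u w + ad v w.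
Proof. by rewrite /ad mulrDr mulrDl opprD addrACA. Qed.

Lemma adNr u v : ad u (- v) = - ad u v.
Proof. by rewrite /ad mulrN mulNr opprD. Qed.

Lemma adM u v w : ad u (v * w) = ad u v * w + v * ad u w.
Proof. by rewrite /ad mulrBl mulrBr !mulrA addrA subrK. Qed.

(** Jacobi identity: a derivation of the product is one of the commutator. *)
Lemma ad_ad u v w : ad u (ad v w) = ad (ad u v) w + ad v (ad u w).
Proof.
rewrite {2}/ad adDr adNr !adM opprD.
by rewrite [- _ - _]addrC addrACA.
Qed.

Lemma iter_scaled_ad c n u v :
  iter n (fun w => c *: ad u w) v = c ^+ n *: iter n (ad u) v.
Proof.
elim: n => [|n IHn]; first by rewrite scale1r.
by rewrite !iterS IHn adZr scalerA -exprS.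
Qed.

Lemma coef_ad (q1 q2 : {poly R}) i :
  (ad q1 q2)`_i = \sum_(j < i.+1) ad q1`_j q2`_(i - j).
Proof. by rewrite coefB coefM coefMr -sumrB. Qed.

Lemma coef_ad_line_poly x y q i :
  (ad (line_poly x y) q)`_i =
  (if i is j.+1 then ad x q`_j else 0) + ad y q`_i.
Proof.
rewrite /ad coefB coef_line_polyM coef_mul_line_poly opprD addrACA.
by case: i => [|i]; rewrite ?subr0.
Qed.

(* ((c x + y)^n - y^n) / c, written so that it makes sense for c = 0. *)
Definition line_quot c x y n : R :=
  \sum_(i < n) c ^+ i *: (line_poly x y ^+ n)`_i.+1.

Lemma line_quot0 c x y : line_quot c x y 0 = 0.
Proof. exact: big_ord0. Qed.

(** Comes from L^(n+1) = L L^n for L = t x + y; the constant coefficient y^n of L^n gives the last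
    term. *)
Lemma line_quotS c x y n :
  line_quot c x y n.+1 = (c *: x + y) * line_quot c x y n + x * y ^+ n.
Proof.
rewrite /line_quot mulrDl addrAC.
under eq_bigr => i _ do rewrite exprS coef_line_polyM scalerDr.
rewrite big_split /=; congr (_ + _).
  rewrite big_ord_recl scale1r coef0_line_exp addrC; congr (_ + _).
  rewrite mulr_sumr; apply: eq_bigr => i _.
  by rewrite exprS -scalerAl -!scalerAr scalerA.
rewrite big_ord_recr /= coef_line_exp_gt // mulr0 scaler0 addr0 mulr_sumr.
by apply: eq_bigr => i _; rewrite scalerAr.
Qed.

Lemma exprD_line_quot c x y n :
  (c *: x + y) ^+ n = y ^+ n + c *: line_quot c x y n.
Proof.
elim: n => [|n IHn]; first by rewrite line_quot0 scaler0 addr0.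
rewrite exprS IHn mulrDr mulrDl -exprS line_quotS scalerDr scalerAr.
by rewrite -scalerAl addrAC addrC [X in _ + X = _]addrC.
Qed.

(** In degrees i + 1 < p the factor i + 1 of [coef_line_exp_pchar] is invertible; the top
    coefficient x^p is split off. *)
Lemma line_quot_pchar p c x y : p \in [pchar k] ->
  line_quot c x y p = c ^+ p.-1 *: x ^+ p +
    \sum_(i < p.-1) (i.+1%:R : k)^-1 *:
      (c ^+ i *: (iter p.-1 (ad (line_poly x y)) x%:P)`_i).
Proof.
move=> pchar_k; have pcharRp : p \in [pchar R] by rewrite pchar_lalg.
rewrite /line_quot; under [in RHS]eq_bigr => i _.
  rewrite -coef_line_exp_pchar // -scaler_nat !scalerA mulrAC.
  rewrite mulVf ?mul1r; last first.
    rewrite -(dvdn_pcharf pchar_k) gtnNdvd //.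
    by rewrite -ltn_predRL.
  over.
have p_gt0 := prime_gt0 (pcharf_prime pchar_k).
rewrite -[in LHS](prednK p_gt0) big_ord_recr /= prednK // coefn_line_exp.
by rewrite addrC.
Qed.

End AdjointAlgebra.

Definition scaled_commutator (k : fieldType) (A : lmodType k)
  (mul : A -> A -> A) (c : k) (x y : A) : A := c *: commutator mul x y.

(** * The axioms, checked through an embedding into a unital algebra *)

Section Embedding.
Variables (k : fieldType) (p : nat) (pchar_k : p \in [pchar k]).
Variables (A : lmodType k) (mul : A -> A -> A) (R : algType k).
Variables (iota : {linear A -> R}) (iota_inj : injective iota).
Hypothesis iotaM : {morph iota : x y / mul x y >-> x * y}.
Variable lambda : k.
Implicit Types x y z : A.

Local Notation br := (scaled_commutator mul lambda).
Local Notation pmap := (fun x : A => lambda ^+ p.-1 *: nested_pow mul p x).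

Let pcharRp : p \in [pchar R]. Proof. by rewrite pchar_lalg. Qed.
Let p_gt0 : (0 < p)%N. Proof. exact: prime_gt0 (pcharf_prime pchar_k). Qed.

Lemma iota_commutator x y : iota (commutator mul x y) = ad (iota x) (iota y).
Proof. by rewrite linearB /= !iotaM. Qed.

Lemma iota_br x y : iota (br x y) = lambda *: ad (iota x) (iota y).
Proof. by rewrite linearZ /= iota_commutator. Qed.

Lemma iota_nested_pow n x :
  (0 < n)%N -> iota (nested_pow mul n x) = iota x ^+ n.
Proof.
case: n => // n _; elim: n => [|n IHn]; first by rewrite expr1.
by rewrite exprS -IHn -iotaM.
Qed.

Lemma iota_iter_br n x y :
  iota (iter n (br x) y) = lambda ^+ n *: iter n (ad (iota x)) (iota y).
Proof. by rewrite -iter_scaled_ad; elim: n => //= n <-; rewrite iota_br. Qed.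

Lemma commutator_bilinear : bilinear_for *:%R *:%R (commutator mul).
Proof.
split=> z c x y; apply: iota_inj; rewrite /= !(linearP, iota_commutator).
  by rewrite adDl adZl.
by rewrite adDr adZr.
Qed.

Lemma scaled_commutator_bilinear : bilinear_for *:%R *:%R br.
Proof.
have [comml commr] := commutator_bilinear.
by split=> z c x y; rewrite /scaled_commutator /= (comml, commr) /=
  scalerDr !scalerA mulrC.
Qed.

Lemma scaled_commutator_lie : lie_algebra br.
Proof.
split=> [|x|x y z]; first exact: scaled_commutator_bilinear.
  by rewrite /scaled_commutator /commutator subrr scaler0.
apply: iota_inj; rewrite !linearD !iota_br linear0 /= !adZr !scalerA -!scalerDr.
rewrite ad_ad (adN (iota z) (iota x)) (adN (iota z)) adNr.
by rewrite addrK subrr scaler0.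
Qed.

(** As t is central, [bracket_t] is the commutator of polynomials up to one factor [lambda] per
    bracket. *)
Lemma iota_iter_bracket_t n x y i :
  iota (iter n (bracket_t br (line_t x y)) (const_t x) i) =
  lambda ^+ n *: (iter n (ad (line_poly (iota x) (iota y))) (iota x)%:P)`_i.
Proof.
have line_coef j : iota (line_t x y j) = (line_poly (iota x) (iota y))`_j.
  rewrite /line_poly coefD coefMX !coefC.
  by case: j => [|[|j]]; rewrite ?add0r ?addr0 ?linear0.
elim: n i => [|n IHn] i.
  by rewrite scale1r coefC; case: i => [|i] //=; rewrite linear0.
rewrite !iterS {1}/bracket_t linear_sum exprS -scalerA.
rewrite coef_ad !scaler_sumr.
apply: eq_bigr => j _.
by rewrite iota_br IHn line_coef adZr.
Qed.

Lemma scaled_commutator_restricted : restricted_lie_algebra p br pmap.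
Proof.
split=> [|c x|x y|x y]; first exact: scaled_commutator_lie.
- apply: iota_inj; rewrite !linearZ /= !iota_nested_pow // linearZ /=.
  by rewrite exprZn !scalerA mulrC.
- apply: iota_inj; rewrite iota_br linearZ /= iota_nested_pow // iota_iter_br.
  by rewrite iter_ad_pchar // adZl scalerA -exprS prednK.
apply: iota_inj; rewrite !linearD !linearZ /= !iota_nested_pow // linearD.
(* Jacobson's formula is the case c = 1; the p - 1 brackets in each s_i supply the factor
   lambda^(p-1). *)
have := exprD_line_quot 1 (iota x) (iota y) p; rewrite !scale1r => ->.
rewrite line_quot_pchar // expr1n scale1r scalerDr scalerDr addrA.
rewrite [X in X + _]addrC; congr (_ + _).
rewrite scaler_sumr big_add1 big_mkord linear_sum; apply: eq_bigr => i _.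
rewrite /jacobson_s [RHS]linearZ /= iota_iter_bracket_t expr1n.
by rewrite scale1r !scalerA mulrC.
Qed.

Variable P : {linear A -> A}.
Hypothesis rota_baxter : forall x y, mul (P x) (P y) =
  P (mul (P x) y) + P (mul x (P y)) + lambda *: P (mul x y).

Local Notation rhd := (fun x y : A => commutator mul (P x) y).

(** The Rota-Baxter identity, antisymmetrized in [x] and [y]. *)
Lemma rota_baxter_commutator x y :
  P (br x y + rhd x y - rhd y x) = commutator mul (P x) (P y).
Proof.
rewrite /scaled_commutator /commutator !rota_baxter.
rewrite !(linearD, linearN, linearZ) /=.
rewrite opprK scalerBr scalerN.
set a := P (mul (P x) y); set b := P (mul x (P y)).
set c := P (mul (P y) x); set d := P (mul y (P x)).
set e := lambda *: P (mul x y); set f := lambda *: P (mul y x).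
by rewrite [LHS](AC (2*2*2) (3*6*1*(5*4*2))).
Qed.

(** Both post-Lie identities reduce to Jacobi, the second through [rota_baxter_commutator]. *)
Lemma rota_baxter_post_lie : post_lie_algebra br rhd.
Proof.
have [comml commr] := commutator_bilinear.
split=> [||x y z|x y z]; first exact: scaled_commutator_lie.
- split=> z c x y /=; last by rewrite commr.
  by rewrite linearP comml.
- apply: iota_inj; rewrite [RHS]linearD /= !(iota_br, iota_commutator).
  by rewrite adZr ad_ad scalerDr.
apply: iota_inj; rewrite rota_baxter_commutator [in RHS]linearB /=.
by rewrite !iota_commutator ad_ad addrK.
Qed.

(** The double product of a Rota-Baxter algebra; its commutator is [br x y + rhd x y - rhd y x]. *)
Definition rb_mul x y : A := mul (P x) y + mul x (P y) + lambda *: mul x y.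

Lemma rb_mulP x y : P (rb_mul x y) = mul (P x) (P y).
Proof. by rewrite rota_baxter !linearD linearZ. Qed.

Lemma rb_powP n x : P (nested_pow rb_mul n x) = nested_pow mul n (P x).
Proof.
by rewrite /nested_pow; elim: n.-1 => //= m IHm; rewrite rb_mulP IHm.
Qed.

(** For w the n-th power of x under [rb_mul], [rb_mul x w] is (lambda x + P x) w + x P(w) with P(w)
    = P(x)^n, which is the recursion [line_quotS]. *)
Lemma iota_rb_pow n x : (0 < n)%N ->
  iota (nested_pow rb_mul n x) = line_quot lambda (iota x) (iota (P x)) n.
Proof.
case: n => // n _; elim: n => [|n IHn].
  by rewrite line_quotS line_quot0 mulr0 add0r expr0 mulr1.
rewrite line_quotS -IHn -(iota_nested_pow _ (ltn0Sn n)) -rb_powP.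
rewrite [LHS]/= !linearD linearZ /= !iotaM mulrDl scalerAl.
by rewrite addrC addrA.
Qed.

Lemma sub_pmap_rb_pow x : sub_pmap p br pmap rhd x = nested_pow rb_mul p x.
Proof.
apply: iota_inj; rewrite iota_rb_pow // line_quot_pchar // /sub_pmap linearD /=.
rewrite linearZ /= iota_nested_pow //; congr (_ + _).
pose brL : {bilinear A -> A -> A} := HB.pack (br : A -> A -> A)
  (bilinear_isBilinear.Build k A A A *:%R *:%R br scaled_commutator_bilinear).
have D_linear : linear (rhd x) by case: commutator_bilinear => _; exact.
pose D : {linear A -> A} := HB.pack (rhd x)
  (GRing.isLinear.Build k A A *:%R (rhd x) D_linear).
have D_br u v : D (brL u v) = brL (D u) v + brL u (D v).
  exact: post_lie_derivation rota_baxter_post_lie x u v.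
(* Degree i in t counts the brackets with x, each worth a factor [lambda]. *)
have twistedE n i : iota (twisted_iter brL D x n i) = lambda ^+ i *:
    (iter n (ad (line_poly (iota x) (iota (P x)))) (iota x)%:P)`_i.
  elim: n i => [|n IHn] i.
    by rewrite /= coefC; case: i => [|i]; rewrite ?scale1r ?linear0 ?scaler0.
  rewrite iterS coef_ad_line_poly twisted_iterS linearD [RHS]scalerDr /=.
  rewrite iota_commutator IHn adZr.
  congr (_ + _); case: i => [|i]; rewrite ?linear0 ?scaler0 //.
  by rewrite iota_br IHn adZr scalerA -exprS.
(* Compositions with r = i + 1 parts correspond to degree i in t. *)
rewrite big_add1 big_mkord linear_sum; apply: eq_bigr => i _.
rewrite -twistedE linearZ; congr (_ *: iota _).
by case: p p_gt0 i => // n _ i; rewrite twisted_iter_comp.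
Qed.

Lemma rota_baxter_restricted_post_lie :
  restricted_post_lie_algebra p br pmap rhd.
Proof.
split=> [||x y|x y]; first exact: rota_baxter_post_lie.
- exact: scaled_commutator_restricted.
(* [P y, x^p] = - (ad x)^p (P y), and the innermost [ad x] turns - P y into [P y, x]. *)
- apply: iota_inj; rewrite iota_commutator linearZ /= iota_nested_pow //.
  rewrite iota_iter_br iota_commutator adZr adN -iter_ad_pchar //.
  congr (_ *: _); rewrite (adN (iota (P y))) -[in LHS](prednK p_gt0) iterSr.
  by elim: p.-1 => //= n <-; rewrite adNr.
(* P(x^[[p]]) = P(x)^p, whose adjoint action is the p-th power of that of P x. *)
apply: iota_inj; rewrite iota_commutator sub_pmap_rb_pow rb_powP.
rewrite iota_nested_pow // -iter_ad_pchar //.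
by elim: {1 2}p => //= n ->; rewrite iota_commutator.
Qed.

End Embedding.

Theorem corollary4p15 (k : closedFieldType) (p : nat) (hp : p \in [pchar k])
    (A : lmodType k) (mul : A -> A -> A) (P : A -> A) (lambda : k)
    (hRB : rota_baxter_algebra lambda mul P) :
  restricted_post_lie_algebra p
    (fun x y : A => lambda *: commutator mul x y)
    (fun x : A => lambda ^+ p.-1 *: nested_pow mul p x)
    (fun x y : A => commutator mul (P x) y).
Proof.
have [assoc_mul P_linear rota_baxter] := hRB.
pose PL : {linear A -> A} :=
  HB.pack P (GRing.isLinear.Build k A A *:%R P P_linear).
exact: (rota_baxter_restricted_post_lie hp (@unitize_inj _ _ _ assoc_mul)
  (@unitizeM _ _ _ assoc_mul) (P := PL) rota_baxter).
Qed.
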